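(* In the setting below, with $Q=L/\mu$ and $K\ge 1$, let $a\ge3$ be an integer, let \[ \overline{\eta}_a=\Big(\frac{1}{144(aK+1)KQ^2}\Big)^{\frac{1}{a-2}}, \] and suppose the step size satisfies $0<\eta\le\frac{1}{3L(K+1)}\overline{\eta}_a$. Then for every integer $k\ge aK+1$, \[ F_k\le\Big(1-\eta\frac{\mu}{18}\Big)^{\frac{k+1}{aK+1}-1}\Big(\max_{0\le j\le aK}F_j\Big). \]
   Context: Let $m,n\ge 1$ be integers and $\|\cdot\|$ the Euclidean norm on $\mathbb{R}^n$. For $i=1,\dots,m$, let $f_i:\mathbb{R}^n\to\mathbb{R}$ be continuously differentiable with $\|\nabla f_i(x)-\nabla f_i(y)\|\le L_i\|x-y\|$ for all $x,y$, where $L_i\ge 0$ (the $f_i$ are not assumed convex). Let $f=\frac1m\sum_{i=1}^m f_i$ and $L=\frac1m\sum_{i=1}^m L_i$. Assume $f$ is $\mu$-strongly convex for some $\mu>0$ (i.e. $x\mapsto f(x)-\frac{\mu}{2}\|x\|^2$ is convex). Let $r:\mathbb{R}^n\to(-\infty,\infty]$ be proper, closed and convex, let $F=f+r$, and let $x^*$ be the unique minimizer of $F$. For $\eta>0$ define $\mathrm{prox}_r^\eta(y)=\arg\min_{x\in\mathbb{R}^n}\{\frac12\|x-y\|^2+\eta r(x)\}$. PIAG method: fix an integer $K$, a step size $\eta>0$ and $x_0\in\mathbb{R}^n$; for each $k\ge0$ and each $i$ let $\tau_{i,k}$ be any (deterministically chosen) integer with $\max(k-K,0)\le\tau_{i,k}\le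 k$; set $g_k=\frac1m\sum_{i=1}^m\nabla f_i(x_{\tau_{i,k}})$ and $x_{k+1}=\mathrm{prox}_r^\eta(x_k-\eta g_k)$. Define $F_k=F(x_k)-F(x^* )$. *)

(* Defs.v *)
From mathcomp Require Import all_boot all_order all_algebra.
From mathcomp Require Import all_classical all_reals all_analysis.
Set Implicit Arguments. Unset Strict Implicit. Unset Printing Implicit Defensive.
Import Order.TTheory GRing.Theory Num.Theory.
Local Open Scope ring_scope.

Section Defs.
Context {R : realType} {n : nat}.
Local Notation V := 'rV[R]_n.

Definition dotv (u v : V) : R := \sum_(j < n) u ord0 j * v ord0 j.
Definition enorm (u : V) : R := Num.sqrt (dotv u u).

Definition has_gradient (f : V -> R) (g : V -> V) : Prop :=
  forall x (eps : R), 0 < eps -> exists2 d : R, 0 < d &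
    forall h : V, enorm h < d -> `|f (x + h) - f x - dotv (g x) h| <= eps * enorm h.

Definition lipschitz_map (g : V -> V) (L : R) : Prop :=
  forall x y, enorm (g x - g y) <= L * enorm (x - y).

Definition convex_fun (phi : V -> R) : Prop :=
  forall (x y : V) (t : R), 0 <= t -> t <= 1 ->
    phi (t *: x + (1 - t) *: y) <= t * phi x + (1 - t) * phi y.

Definition strongly_convex (mu : R) (f : V -> R) : Prop :=
  convex_fun (fun x => f x - mu / 2 * enorm x ^+ 2).

Definition convex_efun (r : V -> \bar R) : Prop :=
  forall (x y : V) (t : R), 0 < t -> t < 1 ->
    (r (t *: x + (1 - t) *: y)%R <= t%:E * r x + (1 - t)%:E * r y)%E.

Definition proper_efun (r : V -> \bar R) : Prop :=
  (forall x, r x != -oo%E) /\ (exists x, r x != +oo%E).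

Definition eclosed (S : V -> Prop) : Prop :=
  forall x, (forall eps : R, 0 < eps -> exists y, S y /\ enorm (y - x) < eps) -> S x.

Definition closed_efun (r : V -> \bar R) : Prop :=
  forall alpha : R, eclosed (fun x => (r x <= alpha%:E)%E).

Definition is_prox (r : V -> \bar R) (eta : R) (y z : V) : Prop :=
  forall w : V,
    ((2^-1 * enorm (z - y) ^+ 2)%:E + eta%:E * r z
     <= (2^-1 * enorm (w - y) ^+ 2)%:E + eta%:E * r w)%E.

End Defs.

(* Main.v *)
Require Import Defs.
From mathcomp Require Import all_boot all_order all_algebra.
From mathcomp Require Import all_classical all_reals all_analysis.
From mathcomp Require Import lra ring.
Import Order.TTheory GRing.Theory Num.Theory.
Local Open Scope ring_scope.

(* One iteration satisfies two inequalities: the descent lemma with the prox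
   inequality tested at x_k,
     F_(k+1) <= F_k - (1/eta - L(K+1)/2) |d_k|^2 + L/2 S_k,
   and strong convexity with the prox inequality tested at the minimizer,
     mu F_(k+1) <= (1/eta + L)^2 |d_k|^2 + L^2 K S_k,
   where d_k = x_(k+1) - x_k and S_k is the sum of the last K squared steps.
   Put rho = 1 - eta mu / 18. Since mu <= L (here n >= 1 matters), the step
   size bound gives 3 eta L (K+1) <= 1, and rho times the first inequality plus
   eta/18 times the second yields
     F_(k+1) <= rho F_k - 9/4 L (K+1) |d_k|^2 + 14/27 L S_k.
   Adding L times the last K squared steps, weighted K for the newest down to 1
   for the oldest, turns F into a Lyapunov function that contracts by rho.
   There are no steps before time 0, so F_k <= rho^k F_0, which is stronger
   than the claim. If r (x_0) = +oo the right-hand side is +oo. *)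

(** * The Euclidean inner product and norm *)

Section Euclid.
Context {R : realType} {n : nat}.
Implicit Types (u v w : 'rV[R]_n) (c : R).

Lemma dotvC u v : dotv u v = dotv v u.
Proof. by apply: eq_bigr => j _; rewrite mulrC. Qed.

Lemma dotvDl u v w : dotv (u + v) w = dotv u w + dotv v w.
Proof. by rewrite -big_split; apply: eq_bigr => j _; rewrite !mxE mulrDl. Qed.

Lemma dotvZl c u w : dotv (c *: u) w = c * dotv u w.
Proof. by rewrite mulr_sumr; apply: eq_bigr => j _; rewrite !mxE mulrA. Qed.

Lemma dotvDr u v w : dotv w (u + v) = dotv w u + dotv w v.
Proof. by rewrite !(dotvC w) dotvDl. Qed.

Lemma dotvZr c u w : dotv w (c *: u) = c * dotv w u.
Proof. by rewrite !(dotvC w) dotvZl. Qed.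

Lemma dotvNl u w : dotv (- u) w = - dotv u w.
Proof. by rewrite -scaleN1r dotvZl mulN1r. Qed.

Lemma dotvNr u w : dotv w (- u) = - dotv w u.
Proof. by rewrite !(dotvC w) dotvNl. Qed.

Lemma dotvv_ge0 u : 0 <= dotv u u.
Proof. by apply: sumr_ge0 => j _; rewrite -expr2 sqr_ge0. Qed.

Lemma enorm_ge0 u : 0 <= enorm u.
Proof. exact: sqrtr_ge0. Qed.

Lemma enorm_sqr u : enorm u ^+ 2 = dotv u u.
Proof. by rewrite sqr_sqrtr ?dotvv_ge0. Qed.

Lemma enorm_eq0 u : enorm u = 0 -> u = 0.
Proof.
move=> u0; have /eqP : dotv u u = 0 by rewrite -enorm_sqr u0 expr0n.
rewrite psumr_eq0 => [/allP h|j _]; last by rewrite -expr2 sqr_ge0.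
apply/rowP => j; have := h j (mem_index_enum _).
by rewrite -expr2 sqrf_eq0 mxE => /eqP.
Qed.

Lemma enorm_gt0 u : u != 0 -> 0 < enorm u.
Proof.
by move=> u0; rewrite lt0r enorm_ge0 andbT; apply: contra_neq u0 => /enorm_eq0.
Qed.

Lemma enorm0 : enorm (0 : 'rV[R]_n) = 0.
Proof. by rewrite /enorm -(scale0r 0) dotvZl mul0r sqrtr0. Qed.

Lemma enormZ c u : enorm (c *: u) = `|c| * enorm u.
Proof.
by rewrite /enorm dotvZl dotvZr mulrA -expr2 sqrtrM ?sqr_ge0// sqrtr_sqr.
Qed.

Lemma enormN u : enorm (- u) = enorm u.
Proof. by rewrite -scaleN1r enormZ normrN1 mul1r. Qed.

Lemma enormD_sqr u v :
  enorm (u + v) ^+ 2 = enorm u ^+ 2 + 2 * dotv u v + enorm v ^+ 2.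
Proof. by rewrite !enorm_sqr !(dotvDl, dotvDr) (dotvC v u); ring. Qed.

(** Cauchy-Schwarz: expand the squared norm of [enorm v *: u - enorm u *: v] and divide by
    [enorm u * enorm v], hence the separate zero cases. *)
Lemma dotv_le u v : dotv u v <= enorm u * enorm v.
Proof.
have [->|/enorm_gt0 u0] := eqVneq u 0.
  by rewrite enorm0 mul0r -(scale0r 0) dotvZl mul0r.
have [->|/enorm_gt0 v0] := eqVneq v 0.
  by rewrite enorm0 mulr0 -(scale0r 0) dotvZr mul0r.
have := dotvv_ge0 (enorm v *: u - enorm u *: v).
rewrite -enorm_sqr enormD_sqr enormN !enormZ !ger0_norm ?enorm_ge0//.
rewrite dotvNr dotvZr dotvZl => h.
rewrite -(ler_pM2l (mulr_gt0 u0 v0)); nra.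
Qed.

Lemma enormD u v : enorm (u + v) <= enorm u + enorm v.
Proof.
rewrite -ler_sqr ?nnegrE ?addr_ge0 ?enorm_ge0// enormD_sqr sqrrD.
by have := dotv_le u v; lra.
Qed.

Lemma enorm_sum (I : Type) (s : seq I) (F : I -> 'rV[R]_n) :
  enorm (\sum_(i <- s) F i) <= \sum_(i <- s) enorm (F i).
Proof.
elim/big_rec2: _ => [|i x y _ le_yx]; first by rewrite enorm0.
by rewrite (le_trans (enormD _ _))// lerD2l.
Qed.

Lemma enorm_telescope (u : nat -> 'rV[R]_n) (K l : nat) : (l <= K)%N ->
  enorm (u l - u K) <= \sum_(j < K) enorm (u j.+1 - u j).
Proof.
elim: K => [|K IH].
  by rewrite leqn0 => /eqP ->; rewrite subrr enorm0 big_ord0.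
rewrite leq_eqVlt ltnS big_ord_recr/= => /predU1P[->|/IH le_lK].
  rewrite subrr enorm0 addr_ge0 ?sumr_ge0 ?enorm_ge0// => j _.
  exact: enorm_ge0.
rewrite -(subrKA (u K)) (le_trans (enormD _ _))// lerD//.
by rewrite -opprB enormN.
Qed.

End Euclid.

(** Replaces the limit t -> 0 in the first-order arguments below. *)
Lemma ler_small (R : realType) (A B C d : R) : 0 < d ->
  (forall t, 0 < t -> t < d -> A <= B + t * C) -> A <= B.
Proof.
move=> d0 h; rewrite leNgt; apply/negP => ltBA.
pose t := Num.min (d / 2) ((A - B) / (2 * (`|C| + 1))).
have C1 : 0 < 2 * (`|C| + 1) by rewrite mulr_gt0// ltr_wpDl.
have t0 : 0 < t by rewrite lt_min !divr_gt0 ?subr_gt0.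
have td : t < d by rewrite /t gt_min; apply/orP; left; lra.
have tC : t * (2 * (`|C| + 1)) <= A - B.
  by rewrite -ler_pdivlMr// /t ge_min lexx orbT.
have := h _ t0 td; have := ler_norm C; nra.
Qed.

(** * Gradients, smoothness and strong convexity *)

Section Smooth.
Import numFieldNormedType.Exports.
Context {R : realType} {n : nat}.
Implicit Types (f : 'rV[R]_n -> R) (g : 'rV[R]_n -> 'rV[R]_n).

Lemma has_gradientD f1 f2 g1 g2 : has_gradient f1 g1 -> has_gradient f2 g2 ->
  has_gradient (fun x => f1 x + f2 x) (fun x => g1 x + g2 x).
Proof.
move=> h1 h2 x e e0; have e2 : 0 < e / 2 by rewrite divr_gt0.
have [d1 d10 {}h1] := h1 x _ e2; have [d2 d20 {}h2] := h2 x _ e2.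
exists (Num.min d1 d2) => [|h]; first by rewrite lt_min d10.
rewrite lt_min => /andP[/h1 H1 /h2 H2]; rewrite dotvDl.
rewrite [X in `|X|](_ : _ = (f1 (x + h) - f1 x - dotv (g1 x) h) +
  (f2 (x + h) - f2 x - dotv (g2 x) h)); last by ring.
by rewrite (le_trans (ler_normD _ _))//; lra.
Qed.

Lemma has_gradientZ f g (c : R) : has_gradient f g ->
  has_gradient (fun x => c * f x) (fun x => c *: g x).
Proof.
move=> hf x e e0; have c1 : 0 < `|c| + 1 by rewrite ltr_wpDl.
have [d d0 {}hf] := hf x _ (divr_gt0 e0 c1).
exists d => // h /hf H; rewrite dotvZl -!mulrBr normrM.
have := ler_wpM2l (normr_ge0 c) H; move/le_trans; apply.
rewrite mulrA ler_wpM2r ?enorm_ge0// mulrA ler_pdivrMr// mulrC.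
by rewrite ler_pM2l// lerDl.
Qed.

Lemma has_gradient_sum (I : Type) (s : seq I) (F : I -> 'rV[R]_n -> R)
    (G : I -> 'rV[R]_n -> 'rV[R]_n) : (forall i, has_gradient (F i) (G i)) ->
  has_gradient (fun x => \sum_(i <- s) F i x) (fun x => \sum_(i <- s) G i x).
Proof.
move=> h; elim: s => [|i s IH].
  move=> x e e0; exists 1 => // y _; rewrite !big_nil subrr sub0r normrN.
  by rewrite -(scale0r 0) dotvZl mul0r normr0 mulr_ge0 ?enorm_ge0 ?ltW.
have := has_gradientD _ _ _ _ (h i) IH.
by congr has_gradient; apply/funext => x; rewrite big_cons.
Qed.

Lemma has_gradient_line f g x h (t : R) : has_gradient f g ->
  is_derive t 1 (fun s : R => f (x + s *: h)) (dotv (g (x + t *: h)) h).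
Proof.
move=> hf; set l := dotv _ _.
suff H : ((fun s : R => s^-1 *: (f (x + (s *: (1 : R) + t) *: h) - f (x + t *: h)))
    @ 0^' --> l)%classic.
  by apply: DeriveDef; [apply/cvg_ex; exists l | apply: cvg_lim].
apply/cvgrPdist_le => /= e e0.
(* The added 1 keeps the divisor positive when [h] is 0. *)
have h1 : 0 < enorm h + 1 by rewrite ltr_wpDl ?enorm_ge0.
have [d d0 H] := hf (x + t *: h) _ (divr_gt0 e0 h1).
exists (d / (enorm h + 1)) => /=; first by rewrite divr_gt0.
move=> s /=; rewrite sub0r normrN => sd s0.
have := H (s *: h); rewrite enormZ.
have sd' : `|s| * enorm h < d.
  rewrite ltr_pdivlMr// in sd; apply: le_lt_trans sd.
  by rewrite ler_wpM2l// lerDl.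
move=> /(_ sd').
rewrite [s *: (1 : R)]mulr1 (_ : x + (s + t) *: h = x + t *: h + s *: h); last first.
  by rewrite scalerDl -addrA (addrC (t *: h)).
rewrite dotvZr -/l => H'.
rewrite /GRing.scale /= distrC -(ler_pM2l (_ : 0 < `|s|)) ?normr_gt0// -normrM.
rewrite mulrBr mulVKf//; apply: (le_trans H').
rewrite mulrCA ler_wpM2l// mulrAC ler_pdivrMr//.
by rewrite ler_wpM2l ?(ltW e0)// lerDl.
Qed.

(** The mean value theorem replaces integration: [psi] subtracts the linear and quadratic terms from
    [f] along the segment, and its derivative is nonpositive by Cauchy-Schwarz and the Lipschitz
    bound. *)
Lemma descent_lemma f g (L : R) x h : has_gradient f g -> lipschitz_map g L ->
  f (x + h) <= f x + dotv (g x) h + L / 2 * enorm h ^+ 2.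
Proof.
move=> hf hL.
pose c := L / 2 * enorm h ^+ 2.
pose psi (t : R) := f (x + t *: h) + (- dotv (g x) h) * t + (- c) * t ^+ 2.
pose dpsi (t : R) := dotv (g (x + t *: h)) h - dotv (g x) h - 2 * c * t.
have dP (t : R) : is_derive t 1 psi (dpsi t).
  have := has_gradient_line f g x h t hf => ?.
  apply: is_derive_eq.
  by rewrite /dpsi /GRing.scale /=; ring.
have psiC : {within `[0, 1], continuous psi}%classic.
  by apply: derivable_within_continuous => t _; have [] := dP t.
have [t] := @MVT _ psi dpsi 0 1 ltr01 (fun t _ => dP t) psiC.
rewrite in_itv/= => /andP[t0 t1].
rewrite subr0 mulr1 /psi scale1r scale0r addr0 => E.
have : dpsi t <= 0.
  rewrite /dpsi -dotvNl -dotvDl.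
  have H1 := dotv_le (g (x + t *: h) - g x) h.
  have := hL (x + t *: h) x.
  rewrite addrAC subrr add0r enormZ (gtr0_norm t0) => H2.
  have := ler_wpM2r (enorm_ge0 h) H2.
  rewrite /c; move: H1; set p := dotv _ _; lra.
by rewrite -E /c; lra.
Qed.

(** Convexity between [x] and [x + h] is divided by t. The inner [ler_small] sends t to 0, the outer
    one the differentiability error [e]. *)
Lemma strongly_convex_gradient f g (mu : R) x h :
  has_gradient f g -> strongly_convex mu f ->
  f x + dotv (g x) h + mu / 2 * enorm h ^+ 2 <= f (x + h).
Proof.
move=> hf hc.
apply: (@ler_small _ _ _ (enorm h) 1) => // e e0 _.
have [d d0 H] := hf x e e0.
have h1 : 0 < enorm h + 1 by rewrite ltr_wpDl ?enorm_ge0.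
apply: (@ler_small _ _ _ (mu / 2 * enorm h ^+ 2)
  (Num.min 1 (d / (enorm h + 1)))) => [|t t0].
  by rewrite lt_min ltr01 divr_gt0.
rewrite lt_min => /andP[t1]; rewrite ltr_pdivlMr// => td.
have := hc (x + h) x t (ltW t0) (ltW t1) => /=.
have -> : t *: (x + h) + (1 - t) *: x = x + t *: h.
  by rewrite scalerDr addrAC -scalerDl (addrC t) subrK scale1r.
rewrite !enormD_sqr dotvZr enormZ (gtr0_norm t0) => C.
have td' : enorm (t *: h) < d.
  rewrite enormZ (gtr0_norm t0); apply: le_lt_trans td.
  by rewrite ler_wpM2l ?(ltW t0)// lerDl.
have := H (t *: h) td'.
rewrite dotvZr enormZ (gtr0_norm t0) ler_norml => /andP[lo _].
rewrite -(ler_pM2l t0); move: C lo.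
set p := dotv x h; set q := dotv (g x) h; lra.
Qed.

Lemma strong_convexity_le_lipschitz f g (mu L : R) : (0 < n)%N ->
  has_gradient f g -> lipschitz_map g L -> strongly_convex mu f -> mu <= L.
Proof.
move=> n0 hg hL hsc; pose h : 'rV[R]_n := const_mx 1.
have h0 : 0 < enorm h.
  apply: enorm_gt0; apply/eqP => /rowP/(_ (Ordinal n0)).
  by rewrite !mxE => /eqP; rewrite oner_eq0.
have := descent_lemma f g L 0 h hg hL.
have := strongly_convex_gradient f g mu 0 h hg hsc.
have := exprn_gt0 2 h0; nra.
Qed.

(** The points [p i] may depend on i: this covers stale gradients with unequal delays, and a
    constant [p] gives the Lipschitz constant of the averaged gradient. *)
Lemma average_lipschitz (m : nat) (G : 'I_m -> 'rV[R]_n -> 'rV[R]_n)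
    (Li : 'I_m -> R) (p : 'I_m -> 'rV[R]_n) y (B : R) :
  (forall i, 0 <= Li i) -> (forall i, lipschitz_map (G i) (Li i)) ->
  (forall i, enorm (p i - y) <= B) ->
  enorm (m%:R^-1 *: (\sum_i G i (p i)) - m%:R^-1 *: \sum_i G i y)
    <= (\sum_i Li i) / m%:R * B.
Proof.
move=> Li0 hL hp; rewrite -scalerBr -sumrB enormZ ger0_norm ?invr_ge0 ?ler0n//.
rewrite (mulrC _ m%:R^-1) -mulrA ler_wpM2l ?invr_ge0 ?ler0n//.
rewrite (le_trans (enorm_sum _ _ _))// mulr_suml ler_sum// => i _.
by rewrite (le_trans (hL i _ _))// ler_wpM2l.
Qed.

End Smooth.

(** * Optimality of the proximal step *)

Section Prox.
Context {R : realType} {n : nat}.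
Context (r : 'rV[R]_n -> \bar R) (eta : R) (y z : 'rV[R]_n).
Context (r_proper : proper_efun r) (eta0 : 0 < eta) (prox_z : is_prox r eta y z).

Lemma prox_fin_num w : r w \is a fin_num -> r z \is a fin_num.
Proof.
move=> /fineK rw; have := prox_z w; rewrite -rw.
case: (r z) (r_proper.1 z) => [c||]// _.
by rewrite mulry gtr0_sg// mul1e addey// leye_eq.
Qed.

(** First-order optimality without subgradients: compare [z] with [t *: w + (1 - t) *: z], use
    convexity of [r], divide by t and let t tend to 0. *)
Lemma prox_le w : convex_efun r -> r w \is a fin_num ->
  eta * fine (r z) + dotv (z - y) (z - w) <= eta * fine (r w).
Proof.
move=> r_convex rw_fin; have rz_fin := prox_fin_num w rw_fin.
apply: (@ler_small _ _ _ (2^-1 * enorm (w - z) ^+ 2) 1) => // t t0 t1.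
have := r_convex w z t t0 t1; have := prox_z (t *: w + (1 - t) *: z).
rewrite -(fineK rw_fin) -(fineK rz_fin) -!EFinM -!EFinD.
set v := t *: w + _ => pz cv.
have rv_fin : r v \is a fin_num.
  by case: (r v) (r_proper.1 v) cv => [c||].
move: pz cv; rewrite -(fineK rv_fin) -!EFinM -!EFinD !lee_fin.
have -> : v - y = (z - y) + t *: (w - z).
  by apply/rowP => j; rewrite !mxE; ring.
rewrite (enormD_sqr (z - y)) dotvZr enormZ (gtr0_norm t0) -(opprB w z) dotvNr.
move: (fine (r v)) (dotv _ _) (enorm (w - z)) (enorm (z - y)) => b p e e' pz cv.
rewrite -(ler_pM2l t0); have := ler_wpM2l (ltW eta0) cv.
by move: pz; rewrite exprMn; lra.
Qed.

End Prox.

(** * One iteration: the two inequalities and their combination *)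

Lemma piag_step_scalar (R : realFieldType) (eta mu L K d s S A B : R) :
  0 < eta -> 0 < mu -> mu <= L -> 1 <= K -> 3 * (eta * L) * (K + 1) <= 1 ->
  s * d <= (S + K * d ^+ 2) / 2 -> s ^+ 2 <= K * S -> 0 <= S ->
  eta * (B - A) <= eta * (L * s * d) - (1 - eta * L / 2) * d ^+ 2 ->
  2 * (eta * mu) * (eta * B) <= (eta * (L * d + L * s) + d) ^+ 2 ->
  B <= (1 - eta * mu / 18) * A - 9 / 4 * L * (K + 1) * d ^+ 2 + 14 / 27 * L * S.
Proof.
move=> eta0 mu0 muL K1 etaL sd s2 S0 H1 H2.
have p0 : 0 < eta * L by rewrite mulr_gt0//; lra.
have zp : eta * mu <= eta * L by rewrite ler_pM2l.
have z0 : 0 < eta * mu by rewrite mulr_gt0.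
have W0 : 0 <= d ^+ 2 := sqr_ge0 d.
have p6 : eta * L <= 1 / 6 by nra.
rewrite -(ler_pM2l eta0).
set p := eta * L in etaL p0 zp p6 *; set z := eta * mu in zp z0 H2 *.
(* 5/6 is a lower bound for 1 - p (K + 1) / 2, as p (K + 1) <= 1/3. *)
have G1 : eta * B <= eta * A + p / 2 * S - 5 / 6 * d ^+ 2.
  have := ler_wpM2l (ltW p0) sd; have := ler_wpM2r W0 etaL.
  move: H1; rewrite (_ : eta * (L * s * d) = p * (s * d)).
    by rewrite -/p; lra.
  by rewrite /p; ring.
(* Here 49/36 = (1 + 1/6)^2 comes from p <= 1/6, and p / 3 from p K <= 1/3. *)
have G2 : z * (eta * B) <= 49 / 36 * d ^+ 2 + p / 3 * S.
  have E : (eta * (L * d + L * s) + d) ^+ 2 <=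
      2 * ((1 + p) ^+ 2 * d ^+ 2 + p ^+ 2 * s ^+ 2).
    have := sqr_ge0 ((1 + p) * d - p * s); rewrite /p; lra.
  have E1 : (1 + p) ^+ 2 * d ^+ 2 <= 49 / 36 * d ^+ 2 by rewrite ler_wpM2r//; nra.
  have E2 : p ^+ 2 * s ^+ 2 <= p / 3 * S.
    apply: le_trans (ler_wpM2l (sqr_ge0 p) s2) _.
    have pK : p * K <= 1 / 3 by nra.
    have := ler_wpM2r (mulr_ge0 (ltW p0) S0) pK; lra.
  move: H2; lra.
(* Add (1 - z/18) [G1] and [G2] / 18. The coefficient of S is at most p/2 + p/54 = 14/27 p. As z <=
   1/6, that of d^2 is at most -5/6 + 5/648 + 49/648 = -3/4 <= -9/4 p (K + 1). *)
have rho0 : 0 <= 1 - z / 18 by lra.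
have := ler_wpM2l rho0 G1.
have zS := mulr_ge0 (ltW z0) (mulr_ge0 (ltW p0) S0).
have zW : z * d ^+ 2 <= 1 / 6 * d ^+ 2 by rewrite ler_wpM2r//; lra.
have := ler_wpM2r W0 etaL.
rewrite (_ : eta * (_ + 14 / 27 * L * S) =
  (1 - z / 18) * (eta * A) - 9 / 4 * p * (K + 1) * d ^+ 2 + 14 / 27 * p * S).
  lra.
by rewrite /p /z; ring.
Qed.

(** Delays enter only through the bound on [gk - g x0]; the [D j] will be the last K step
    lengths. *)
Lemma piag_step (R : realType) (n : nat) (f : 'rV[R]_n -> R) g (L mu : R)
    (r : 'rV[R]_n -> \bar R) (eta : R) (K : nat) (x0 x1 xs gk : 'rV[R]_n)
    (D : 'I_K -> R) :
  let F x := f x + fine (r x) in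
  has_gradient f g -> lipschitz_map g L -> strongly_convex mu f ->
  proper_efun r -> convex_efun r ->
  0 < eta -> 0 < mu -> mu <= L -> (1 <= K)%N ->
  3 * (eta * L) * (K%:R + 1) <= 1 ->
  is_prox r eta (x0 - eta *: gk) x1 ->
  r x0 \is a fin_num -> r xs \is a fin_num ->
  enorm (gk - g x0) <= L * \sum_j D j -> (forall j, 0 <= D j) ->
  F x1 - F xs <= (1 - eta * mu / 18) * (F x0 - F xs)
    - 9 / 4 * L * (K%:R + 1) * enorm (x1 - x0) ^+ 2
    + 14 / 27 * L * \sum_j D j ^+ 2.
Proof.
move=> F hg hL hsc rp rc eta0 mu0 muL K1 etaL px rx0 rxs hE D0.
set s := \sum_j D j in hE; set S := \sum_j D j ^+ 2.
set d := enorm (x1 - x0).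
have d0 : 0 <= d := enorm_ge0 _.
have s0 : 0 <= s by apply: sumr_ge0.
have L0 : 0 < L by lra.
(* Taking c = d bounds s d, and c = s / K gives s^2 <= K S. *)
have quad c : 2 * (c * s) <= S + K%:R * c ^+ 2.
  have : \sum_j 2 * (c * D j) <= \sum_j (D j ^+ 2 + c ^+ 2).
    by apply: ler_sum => j _; have := sqr_ge0 (D j - c); lra.
  by rewrite -!mulr_sumr big_split/= sumr_const card_ord -[_ *+ K]mulr_natl.
have K0 : 1 <= K%:R :> R by rewrite ler1n.
apply: (@piag_step_scalar _ _ _ _ K%:R d s) => //.
- by have := quad d; lra.
- have := quad (s / K%:R).
  have -> : K%:R * (s / K%:R) ^+ 2 = s ^+ 2 / K%:R by field; lra.
  rewrite mulrAC -expr2 -lerBlDr => h.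
  have : s ^+ 2 / K%:R <= S by lra.
  by rewrite ler_pdivrMr ?[S * _]mulrC//; lra.
- by apply: sumr_ge0 => j _; exact: sqr_ge0.
- have := descent_lemma f g L x0 (x1 - x0) hg hL.
  rewrite (addrC x0) subrK => D1.
  have := prox_le r eta _ x1 rp eta0 px x0 rc rx0.
  rewrite opprB addrA (addrAC x1) dotvDl dotvZl -enorm_sqr -/d => P.
  have := dotv_le (g x0 - gk) (x1 - x0); rewrite -opprB enormN -/d => C.
  have := ler_wpM2r d0 hE => hE'.
  have := ler_wpM2l (ltW eta0) D1; rewrite -/d.
  move: C; rewrite opprB dotvDl dotvNl => C.
  have := ler_wpM2l (ltW eta0) (le_trans C hE').
  rewrite /F; lra.
- have := strongly_convex_gradient f g mu x1 (xs - x1) hg hsc.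
  rewrite (addrC x1) subrK -opprB dotvNr enormN => C.
  have := prox_le r eta _ x1 rp eta0 px xs rc rxs.
  rewrite opprB addrA (addrAC x1) dotvDl dotvZl => P.
  set u := x1 - xs in C P.
  set N := eta * _ + d.
  have u0 := enorm_ge0 u.
  have G : eta * dotv (gk - g x1) (- u) - dotv (x1 - x0) u <= N * enorm u.
    have G1 := dotv_le (gk - g x1) (- u); rewrite enormN in G1.
    have G2 := dotv_le (x1 - x0) (- u); rewrite enormN dotvNr -/d in G2.
    have G3 : enorm (gk - g x1) <= L * d + L * s.
      rewrite -(subrKA (g x0)) (le_trans (enormD _ _))// addrC lerD//.
      by rewrite -opprB enormN; exact: hL.
    have := ler_wpM2l (ltW eta0) (le_trans G1 (ler_wpM2r u0 G3)).
    rewrite /N; lra.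
  have H : eta * (F x1 - F xs) <= N * enorm u - eta * mu / 2 * enorm u ^+ 2.
    move: G; rewrite dotvNr dotvDl dotvNl.
    have := ler_wpM2l (ltW eta0) C; rewrite /F; lra.
  (* Completing the square in [enorm u] eliminates the unknown distance from [x1] to [xs]. *)
  have em : 0 < eta * mu by rewrite mulr_gt0.
  have := ler_wpM2l (ltW em) H.
  have := sqr_ge0 (N - eta * mu * enorm u); lra.
Qed.

(** * Geometric decay of the Lyapunov function *)

Lemma lyapunov_decay (R : realFieldType) (K : nat) (L q : R) (A w : nat -> R) :
  (1 <= K)%N -> 0 <= L -> 0 <= q -> q * K%:R <= 1 / 54 ->
  (forall j, 0 <= w j) -> (forall j, (j < K)%N -> w j = 0) ->
  (forall k, A k.+1 <= (1 - q) * A k - 9 / 4 * L * (K%:R + 1) * w (k + K)%N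
                       + 14 / 27 * L * \sum_(j < K) w (k + j)%N) ->
  forall k, A k <= (1 - q) ^+ k * A 0.
Proof.
move=> K1 L0 q0 qK w0 wK step.
have K0 : 1 <= K%:R :> R by rewrite ler1n.
(* The weight j+1 counts the future windows in which w (k + j) still occurs. *)
pose V k := A k + L * \sum_(j < K) j.+1%:R * w (k + j)%N.
suff HV k : V k <= (1 - q) ^+ k * A 0.
  move=> k; apply: le_trans (HV k); rewrite lerDl mulr_ge0// sumr_ge0// => j _.
  by rewrite mulr_ge0.
elim: k => [|k IH].
  rewrite expr0 mul1r /V big1 ?mulr0 ?addr0// => j _.
  by rewrite add0n wK ?mulr0.
rewrite exprS -mulrA; apply: le_trans (ler_wpM2l _ IH); last by nra.
rewrite /V; set S1 := \sum_(j < K) _; set S2 := \sum_(j < K) _.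
pose S := \sum_(j < K) w (k + j)%N.
(* Sliding the window lowers each old weight by one and admits the newest term with weight K. *)
have S1E : S1 = S2 - S + K%:R * w (k + K)%N.
  rewrite /S2 /S -sumrB.
  transitivity (\sum_(j < K.+1) j%:R * w (k + j)%N).
    rewrite big_ord_recl mul0r add0r.
    by apply: eq_bigr => j _; rewrite addSnnS.
  rewrite big_ord_recr/=; congr (_ + _); apply: eq_bigr => j _.
  by rewrite -natr1 mulrDl mul1r addrK.
have S2S : S2 <= K%:R * S.
  rewrite /S2 /S mulr_sumr ler_sum// => j _.
  by rewrite ler_wpM2r// ler_nat.
have S0 : 0 <= S by apply: sumr_ge0.
(* The released S pays for 14/27 S + S/54 = 29/54 S; the new K w (k + K) is absorbed by 9/4 (K + 1)
   w (k + K). *)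
have H1 : q * S2 <= S / 54.
  have := ler_wpM2l q0 S2S; have := ler_wpM2r S0 qK; lra.
have := ler_wpM2l L0 H1.
have := mulr_ge0 L0 (w0 (k + K)%N).
have := mulr_ge0 (mulr_ge0 L0 (w0 (k + K)%N)) (ler0n R K).
have := mulr_ge0 L0 S0.
by have := step k; rewrite S1E -/S; lra.
Qed.

(** * Application to the PIAG iterates *)

Theorem theorem2 (R : realType) (m n : nat) (hm : (1 <= m)%N) (hn : (1 <= n)%N)
  (fi : 'I_m -> 'rV[R]_n -> R) (gfi : 'I_m -> 'rV[R]_n -> 'rV[R]_n)
  (Li : 'I_m -> R)
  (hgrad : forall i, has_gradient (fi i) (gfi i))
  (hLi0 : forall i, 0 <= Li i)
  (hLip : forall i, lipschitz_map (gfi i) (Li i))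
  (mu : R) (hmu : 0 < mu)
  (hsc : strongly_convex mu (fun x => (\sum_(i < m) fi i x) / m%:R))
  (r : 'rV[R]_n -> \bar R)
  (hrp : proper_efun r) (hrc : closed_efun r) (hrcv : convex_efun r)
  (xs : 'rV[R]_n)
  (hxs : forall y, (((\sum_(i < m) fi i xs) / m%:R)%:E + r xs
                    <= ((\sum_(i < m) fi i y) / m%:R)%:E + r y)%E)
  (K : nat) (hK : (1 <= K)%N) (a : nat) (ha : (3 <= a)%N)
  (eta : R) (heta0 : 0 < eta)
  (heta : eta <= (3 * ((\sum_(i < m) Li i) / m%:R) * (K%:R + 1))^-1 *
      ((144 * (a * K + 1)%:R * K%:R *
          (((\sum_(i < m) Li i) / m%:R) / mu) ^+ 2)^-1) `^ ((a - 2)%:R^-1))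
  (tau : nat -> 'I_m -> nat)
  (htau : forall k i, (k - K <= tau k i)%N /\ (tau k i <= k)%N)
  (x : nat -> 'rV[R]_n)
  (hx : forall k, is_prox r eta
          (x k - eta *: ((m%:R)^-1 *: \sum_(i < m) gfi i (x (tau k i))))
          (x k.+1)) :
  let F := fun y => (((\sum_(i < m) fi i y) / m%:R)%:E + r y)%E in
  let Fk := fun k => (F (x k) - F xs)%E in
  forall k : nat, (a * K + 1 <= k)%N ->
    (Fk k <= ((1 - eta * mu / 18) `^ ((k.+1)%:R / (a * K + 1)%:R - 1))%:E *
             \big[Order.max/-oo%E]_(j < (a * K).+1) Fk j)%E.
Proof.
set L := (\sum_(i < m) Li i) / m%:R in heta *.
pose f (y : 'rV[R]_n) := (\sum_(i < m) fi i y) / m%:R.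
pose g (y : 'rV[R]_n) := m%:R^-1 *: \sum_(i < m) gfi i y.
have hf : has_gradient f g.
  have := has_gradientZ _ _ m%:R^-1 (has_gradient_sum _ (index_enum _) _ _ hgrad).
  by congr has_gradient; apply/funext => y; rewrite mulrC.
have delayed_gradient (p : 'I_m -> 'rV[R]_n) y B :
    (forall i, enorm (p i - y) <= B) ->
    enorm (m%:R^-1 *: (\sum_(i < m) gfi i (p i)) - g y) <= L * B.
  exact: average_lipschitz.
have hg : lipschitz_map g L by move=> u v; exact: delayed_gradient (fun=> u) _ _ _.
have muL : mu <= L := strong_convexity_le_lipschitz f g mu L hn hf hg hsc.
have L0 : 0 < L := lt_le_trans hmu muL.
clearbody L.
have K1 : 1 <= K%:R :> R by rewrite ler1n.
have etaL : 3 * (eta * L) * (K%:R + 1) <= 1.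
  have c0 : 0 < 3 * L * (K%:R + 1).
    by rewrite !mulr_gt0//; lra.
  suff : eta <= (3 * L * (K%:R + 1))^-1.
    by rewrite -[_^-1]mul1r ler_pdivlMr//; lra.
  apply: le_trans heta _; rewrite ler_piMr ?invr_ge0 ?(ltW c0)//.
  (* Since L / mu >= 1, [b] is at least 1, so the power of its inverse is at most 1. *)
  set b := 144 * _ * _ * _.
  have b1 : 1 <= b.
    have Q1 : 1 <= (L / mu) ^+ 2 by rewrite exprn_ege1// ler_pdivlMr// mul1r.
    have N1 : 1 <= (a * K + 1)%:R :> R by rewrite ler1n addn1.
    by apply: mulr_ege1 Q1; apply: mulr_ege1 K1; apply: mulr_ege1 N1;
      rewrite ler1n.
  apply: (@le_trans _ _ (1 `^ (a - 2)%:R^-1)); last by rewrite powR1.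
  rewrite ge0_ler_powR ?nnegrE ?invr_ge0 ?ler0n//.
    by rewrite (le_trans ler01).
  by rewrite invf_le1// (lt_le_trans ltr01).
have em0 : 0 < eta * mu by rewrite mulr_gt0.
have emK : eta * mu / 18 * K%:R <= 1 / 54.
  have : eta * mu <= eta * L by rewrite ler_pM2l.
  move=> h; have := ler_wpM2r (ler0n R K) h; nra.
have rho : 0 < 1 - eta * mu / 18 <= 1 by apply/andP; split; nra.
move=> F Fk k ka; set e := _ - 1.
have max_ge : (Fk 0%N <= \big[Order.max/-oo]_(j < (a * K).+1) Fk j)%E.
  exact: (le_bigmax _ (fun j : 'I_(a * K).+1 => Fk j) ord0).
have rxs : r xs \is a fin_num.
  have [y ry] := hrp.2; have := hxs y.
  case: (r xs) (hrp.1 xs) => [c||]// _.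
  by case: (r y) ry (hrp.1 y) => [c||].
have rho_e : 0 < (1 - eta * mu / 18) `^ e by rewrite powR_gt0//; case/andP: rho.
have [rx0|rx0] := boolP (r (x 0%N) \is a fin_num); last first.
  have Fk0 : Fk 0%N = +oo%E.
    rewrite /Fk /F; case: (r (x 0%N)) (hrp.1 (x 0%N)) rx0 => [c||]// _ _.
    by case: (r xs) rxs.
  move: max_ge; rewrite Fk0 leye_eq => /eqP ->.
  by rewrite gt0_muley ?lte_fin// leey.
have rx j : r (x j) \is a fin_num.
  by elim: j => // j; exact: (prox_fin_num _ _ _ _ hrp heta0 (hx j)).
pose Phi y := f y + fine (r y).
have FkE j : Fk j = (Phi (x j) - Phi xs)%:E.
  by rewrite /Fk /F /Phi -(fineK (rx j)) -(fineK rxs).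
have Fk0_ge0 : 0 <= Phi (x 0%N) - Phi xs.
  by rewrite subr_ge0 -lee_fin /Phi !EFinD !fineK//; exact: hxs.
apply: le_trans (lee_wpmul2l _ max_ge); last by rewrite lee_fin ltW.
rewrite !FkE -EFinM lee_fin.
(* Shifting the index by K and truncating the subtraction extends x by x 0 to
   negative times, so that all windows of length K are full. *)
pose w j := enorm (x (j.+1 - K)%N - x (j - K)%N) ^+ 2.
have decay : Phi (x k) - Phi xs <=
    (1 - eta * mu / 18) ^+ k * (Phi (x 0%N) - Phi xs).
  apply: (@lyapunov_decay _ K L _ (fun j => Phi (x j) - Phi xs) w) => //.
  - exact: ltW.
  - by rewrite divr_ge0// ltW.
  - by move=> j; exact: sqr_ge0.
  (* [leq] unfolds to a truncated difference equal to 0, so both bounds rewrite the indices to 0. *)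
  - move=> j jK; rewrite /w; have /eqP -> := ltnW jK; have /eqP -> := jK.
    by rewrite subrr enorm0 expr0n.
  move=> j; rewrite /w -addSn !addnK.
  apply: (@piag_step _ _ f g L mu r eta K (x j) (x j.+1) xs _
    (fun l => enorm (x ((j + l).+1 - K)%N - x (j + l - K)%N))) => //.
  - apply: delayed_gradient => i.
    have [lo hi] := htau j i.
    (* In the shifted window, this index is the stale iterate [x (tau j i)] and index K is [x j]. *)
    have := enorm_telescope (fun l => x (j + l - K)%N) K (tau j i + K - j)%N _.
    rewrite addnK subnKC; last by rewrite addnC -leq_subLR.
    rewrite addnK; under eq_bigr => l _ do rewrite addnS.
    by apply; rewrite leq_subLR leq_add2r.
  - by move=> l; exact: enorm_ge0.
apply: le_trans decay _; apply: ler_wpM2r => //.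
rewrite -powR_mulrn; last by case/andP: rho => /ltW.
(* The base lies in (0, 1], so it suffices that (k + 1) / (a K + 1) - 1 <= k. *)
apply: ger_powR => //; rewrite /e.
have N1 : 1 <= (a * K + 1)%:R :> R by rewrite ler1n addn1.
rewrite lerBlDr natr1 ler_pdivrMr; last exact: lt_le_trans N1.
by rewrite ler_peMr.
Qed.
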